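(* Let $R$ be a regular local ring of dimension $d\ge 2$, let $0\le i\le d-2$, and let $V\in\mathcal{M}_{d-i}(R)$ be a valuation ring which is a monoidal Shannon extension of $R$. Then $$\dim V\le i+2.$$
   Context: Let $(R,\mathfrak{m})$ be a regular local ring. A prime ideal $\mathfrak{p}$ of $R$ is a regular prime if $R/\mathfrak{p}$ is a regular local ring. If $\mathfrak{p}$ is a regular prime of $R$ with $\mathrm{ht}\,\mathfrak{p}\ge 2$, $x\in\mathfrak{p}\setminus\mathfrak{p}^2$, and $\mathfrak{m}_1$ is a maximal ideal of $R[\mathfrak{p}/x]$ with $\mathfrak{m}_1\cap R=\mathfrak{m}$, then $R_1=R[\mathfrak{p}/x]_{\mathfrak{m}_1}$ is called a local monoidal transform of $R$ (it is again a regular local ring). A monoidal Shannon extension of $R$ is a ring $S=\bigcup_{n\ge 0}R_n$ where $R_0=R$, $\{(R_n,\mathfrak{m}_n)\}_{n\ge 0}$ is an infinite sequence in which each $R_{n+1}=R_n[\mathfrak{p}_n/x_n]_{\mathfrak{m}_{n+1}}$ is a local monoidal transform of $R_n$ (with $\mathfrak{p}_n$ a regular prime of $R_n$ of height at least $2$, $x_n\in\mathfrak{p}_n\setminus\mathfrak{p}_n^2$, $\mathfrak{m}_n\subseteq\mathfrak{m}_{n+1}$), and all $R_n$ have the same dimension $d=\dim R\ge 2$. For $2\le j\le d$, $\mathcal{M}_j(R)$ denotes the set of monoidal Shannon extensions of $R$ (given with a defining sequence) such that $\mathrm{ht}\,\mathfrak{p}_n\ge j$ for every $n$. *)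

(* Defs.v *)
From HB Require Import structures.
From mathcomp Require Import all_boot all_order all_algebra.
From mathcomp Require Import ring_quotient fraction.
From mathcomp Require Import boolp.

Set Implicit Arguments.
Unset Strict Implicit.
Unset Printing Implicit Defensive.

Import GRing.Theory.
Local Open Scope ring_scope.
Local Open Scope quotient_scope.

(* Ideals are the [idealr] of ring_quotient, which are proper ideals (they do
   not contain 1); prime ideals are its [prime_idealr]. *)

Section CommutativeAlgebra.
Variable A : comNzRingType.

Definition maximal_ideal (m : idealr A) : Prop :=
  forall J : idealr A, {subset m <= J} -> m =i J.

Definition local_ring (m : idealr A) : Prop :=
  maximal_ideal m /\ forall J : idealr A, maximal_ideal J -> J =i m.

Definition generated_by (I : idealr A) (n : nat) : Prop :=
  exists g : 'I_n -> A,
    forall x : A, x \in I <-> exists c : 'I_n -> A, x = \sum_(i < n) c i * g i.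

(* The unit ideal is not an [idealr], but it is always finitely generated. *)
Definition noetherian : Prop :=
  forall I : idealr A, exists n : nat, generated_by I n.

Definition min_generators (I : idealr A) (n : nat) : Prop :=
  generated_by I n /\ forall k : nat, generated_by I k -> (n <= k)%N.

(* P_0 < P_1 < ... < P_n: a chain of length n, with n + 1 primes *)
Definition prime_chain (n : nat) (P : 'I_n.+1 -> prime_idealr A) : Prop :=
  forall i j : 'I_n.+1, (i < j)%N ->
    {subset P i <= P j} /\ ~ {subset P j <= P i}.

Definition krull_dim_le (n : nat) : Prop :=
  forall (k : nat) (P : 'I_k.+1 -> prime_idealr A),
    prime_chain P -> (k <= n)%N.

Definition krull_dim_eq (n : nat) : Prop :=
  (exists P : 'I_n.+1 -> prime_idealr A, prime_chain P) /\ krull_dim_le n.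

Definition height_ge (p : prime_idealr A) (n : nat) : Prop :=
  exists (k : nat) (P : 'I_k.+1 -> prime_idealr A),
    [/\ (n <= k)%N, prime_chain P & P ord_max =i p].

Definition ideal_square (I : idealr A) (x : A) : Prop :=
  exists (n : nat) (a b : 'I_n -> A),
    (forall i, a i \in I /\ b i \in I) /\ x = \sum_(i < n) a i * b i.

Definition regular_local_ring : Prop :=
  noetherian /\
  exists m : idealr A, local_ring m /\
    exists d : nat, krull_dim_eq d /\ min_generators m d.

End CommutativeAlgebra.

Definition regular_prime (A : comNzRingType) (p : prime_idealr A) : Prop :=
  regular_local_ring {ideal_quot p}.

Definition subring_type (K : fieldType) (A : subringClosed K) : Type :=
  {z : K | z \in A}.

HB.instance Definition _ (K : fieldType) (A : subringClosed K) :=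
  SubChoice.on (subring_type A).
HB.instance Definition _ (K : fieldType) (A : subringClosed K) :=
  [SubChoice_isSubComNzRing of subring_type A by <:].

Section Adjoin.
Variables (K : fieldType) (A : subringClosed K).
Variables (p : idealr (subring_type A)) (x : subring_type A).

(* A[p/x]: the smallest subring of K containing A and all a / x with a in p *)
Definition adjoin_pred (z : K) : bool :=
  `[< forall T : subringClosed K, {subset A <= T} ->
        (forall a : subring_type A, a \in p -> \val a / \val x \in T) ->
        z \in T >].

Lemma adjoin_subring_closed : subring_closed adjoin_pred.
Proof.
split=> [|u v /asboolP hu /asboolP hv|u v /asboolP hu /asboolP hv];
  apply/asboolP=> T hA hp; first exact: rpred1.
- by rewrite rpredB ?hu ?hv.
- by rewrite rpredM ?hu ?hv.
Qed.

HB.instance Definition _ :=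
  GRing.isSubringClosed.Build K adjoin_pred adjoin_subring_closed.

Definition adjoin : subringClosed K :=
  GRing.SubringClosed.clone K adjoin_pred _.

End Adjoin.

(* L is the localization B_q, as a subring of K *)
Definition is_localization (K : fieldType) (B : subringClosed K)
    (q : idealr (subring_type B)) (L : subringClosed K) : Prop :=
  forall z : K, z \in L <->
    exists a s : subring_type B, s \notin q /\ z = \val a / \val s.

(* A1 is the local monoidal transform A[p/x]_{m1} of (A, m). That A1 is again
   a regular local ring is a theorem and is not part of the definition. *)
Definition local_monoidal_transform (K : fieldType) (A : subringClosed K)
    (p : prime_idealr (subring_type A)) (x : subring_type A)
    (A1 : subringClosed K) : Prop :=
  [/\ regular_prime p, height_ge p 2, x \in p, ~ ideal_square p x &
    exists (m : idealr (subring_type A))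
           (m1 : idealr (subring_type (adjoin p x))),
      [/\ local_ring m, maximal_ideal m1,
          (forall a : subring_type A,
             a \in m <-> exists2 b, b \in m1 & \val b = \val a) &
          is_localization m1 A1]].

Section BaseRing.
Variable R : idomainType.

(* the copy of R inside its fraction field *)
Definition base_pred (z : {fraction R}) : bool :=
  `[< exists r : R, z = tofrac r >].

Lemma base_subring_closed : subring_closed base_pred.
Proof.
split=> [|_ _ /asboolP[r ->] /asboolP[s ->]|_ _ /asboolP[r ->] /asboolP[s ->]];
  apply/asboolP.
- by exists 1; rewrite rmorph1.
- by exists (r - s); rewrite rmorphB.
- by exists (r * s); rewrite rmorphM.
Qed.

HB.instance Definition _ :=
  GRing.isSubringClosed.Build {fraction R} base_pred base_subring_closed.

Definition base_subring : subringClosed {fraction R} :=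
  GRing.SubringClosed.clone {fraction R} base_pred _.

(* S belongs to M_j(R) *)
Definition monoidal_Shannon (j : nat) (S : subringClosed {fraction R}) : Prop :=
  exists (Rn : nat -> subringClosed {fraction R})
         (p : forall n, prime_idealr (subring_type (Rn n)))
         (x : forall n, subring_type (Rn n)),
    [/\ Rn 0%N =i base_subring,
        (forall n k,
           krull_dim_eq (subring_type (Rn n)) k <-> krull_dim_eq R k),
        (forall n, local_monoidal_transform (p n) (x n) (Rn n.+1)),
        (forall n, height_ge (p n) j) &
        (forall z, z \in S <-> exists n, z \in Rn n)].

End BaseRing.

(* V is a valuation ring of the field K; in particular K is the fraction field
   of V. *)
Definition valuation_ring (K : fieldType) (V : subringClosed K) : Prop :=
  forall z : K, z != 0 -> z \in V \/ z^-1 \in V.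

(* Main.v *)
(* Let P_0 < P_1 < ... < P_k be primes of V, with p_n the center of the n-th
   transform.  If p_n is not contained in P_2 for all n >= N, then
   blowing up p_n does not affect the local ring at P_2, so V_{P_2} is a
   localization of R_N, which is noetherian; but a noetherian valuation ring has
   dimension at most 1.  Hence p_n <= P_2 for arbitrarily large n; for such n
   large enough P_2, ..., P_k contract to distinct primes of R_n containing p_n,
   and k - 2 <= dim R_n - ht p_n <= i. *)
Require Import Defs.
From HB Require Import structures.
From mathcomp Require Import all_boot all_order all_algebra.
From mathcomp Require Import ring_quotient fraction.
From mathcomp Require Import boolp ring zify.

Set Implicit Arguments.
Unset Strict Implicit.
Unset Printing Implicit Defensive.

Import GRing.Theory.
Local Open Scope ring_scope.

(** Dependent choice where each choice sees all earlier ones, listed by [mkseq g n]. A choice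
    function [F] on lists is iterated; [y0] is its default on lists that leave [Q]. *)
Lemma dependent_sequence (T : eqType) (Q : T -> Prop) (P : seq T -> T -> Prop) :
  (forall s, (forall x, x \in s -> Q x) -> exists y, Q y /\ P s y) ->
  exists g : nat -> T, forall n, Q (g n) /\ P (mkseq g n) (g n).
Proof.
move=> step.
have [//|y0 _] := step [::].
have /choice[F FP] s : exists y, (forall x, x \in s -> Q x) -> Q y /\ P s y.
  have [/step[y yP]|nsQ] := pselect (forall x, x \in s -> Q x).
    by exists y => _.
  by exists y0 => /nsQ.
pose h n := iter n (fun s => rcons s (F s)) [::].
have hE n : mkseq (F \o h) n = h n by elim: n => // n IHn; rewrite mkseqS IHn.
have hQ n x : x \in h n -> Q x.
  elim: n x => //= n IHn x; rewrite mem_rcons inE => /orP[/eqP->|/IHn//].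
  by have [] := FP _ IHn.
by exists (F \o h) => n; rewrite hE; apply/FP/hQ.
Qed.

(** * Noetherian subrings of a field, through sequences of elements *)

Section Noetherian.
Variable K : fieldType.
Implicit Types (B L : subringClosed K) (f g : nat -> K).

(** Generators and coefficients are indexed by [nat], so that [n] can vary without casts between
    ordinals. *)
Definition in_span (B : {pred K}) n f (x : K) : Prop :=
  exists2 c : nat -> K, (forall k, c k \in B) & x = \sum_(k < n) c k * f k.

(* A sequence form of the ascending chain condition. *)
Definition noeth (B : {pred K}) : Prop :=
  forall f, (forall n, f n \in B) -> exists n, in_span B n f (f n).

Lemma eq_noeth (B L : {pred K}) : B =i L -> noeth B -> noeth L.
Proof.
move=> BL Bn f fL; have [|n [c cB fE]] := Bn f; first by move=> n; rewrite BL.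
by exists n, c => // k; rewrite -BL.
Qed.

Lemma eq_in_span (B : {pred K}) n f g x :
  (forall k, (k < n)%N -> f k = g k) -> in_span B n f x -> in_span B n g x.
Proof.
by move=> fg [c cB ->]; exists c => //; apply: eq_bigr => k _; rewrite fg.
Qed.

Lemma in_span0 B n f : in_span B n f 0.
Proof.
exists (fun=> 0) => [k|]; first exact: rpred0.
by rewrite big1 // => k _; rewrite mul0r.
Qed.

Lemma in_spanD B n f x y :
  in_span B n f x -> in_span B n f y -> in_span B n f (x + y).
Proof.
move=> [c cB ->] [c' cB' ->]; exists (fun k => c k + c' k) => [k|].
  by rewrite rpredD.
by rewrite -big_split; apply: eq_bigr => k _; rewrite mulrDl.
Qed.

Lemma in_spanZ B n f a x : a \in B -> in_span B n f x -> in_span B n f (a * x).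
Proof.
move=> aB [c cB ->]; exists (fun k => a * c k) => [k|]; first by rewrite rpredM.
by rewrite mulr_sumr; apply: eq_bigr => k _; rewrite mulrA.
Qed.

Lemma in_span_gen B n f k : (k < n)%N -> in_span B n f (f k).
Proof.
move=> kn; exists (fun j => (j == k)%:R) => [j|]; first by rewrite rpred_nat.
rewrite (bigD1 (Ordinal kn)) //= eqxx mul1r big1 ?addr0 // => j.
by rewrite -val_eqE /= => /negPf->; rewrite mul0r.
Qed.

Lemma in_span_sum B n f m (F : nat -> K) :
  (forall k, (k < m)%N -> in_span B n f (F k)) ->
  in_span B n f (\sum_(k < m) F k).
Proof.
elim: m => [|m IHm] FP; first by rewrite big_ord0; apply: in_span0.
rewrite big_ord_recr /=; apply: in_spanD; last exact: FP.
by apply: IHm => k km; apply/FP/ltnW.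
Qed.

Lemma in_span_trans B n f m g x :
  (forall k, (k < n)%N -> in_span B m g (f k)) ->
  in_span B n f x -> in_span B m g x.
Proof.
move=> fg [c cB ->]; apply: (in_span_sum (F := fun k => c k * f k)) => k kn.
by apply: in_spanZ => //; apply: fg.
Qed.

Lemma in_span_le B n m f x : (n <= m)%N -> in_span B n f x -> in_span B m f x.
Proof.
by move=> nm; apply: in_span_trans => k kn; apply/in_span_gen/(leq_trans kn).
Qed.

(** Otherwise one could always pick an element of [I] outside the span of the earlier picks, and the
    resulting sequence would contradict [noeth B]. The set [I] may be any subset of [B]. *)
Lemma noeth_finitely_generated B (I : K -> Prop) :
  noeth B -> (forall x, I x -> x \in B) ->
  exists s : seq K, (forall x, x \in s -> I x) /\
    forall x, I x -> in_span B (size s) (nth 0 s) x.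
Proof.
move=> Bn IB; apply: contrapT => nofg.
have [s sI|g gP] := @dependent_sequence _ I
  (fun s y => ~ in_span B (size s) (nth 0 s) y).
  apply: contrapT => no; apply: nofg; exists s; split=> // x Ix.
  by apply: contrapT => ?; apply: no; exists x.
have [|n gn] := Bn g; first by move=> n; apply/IB; have [] := gP n.
have [_] := gP n; rewrite size_mkseq; apply.
by apply: eq_in_span gn => k kn; rewrite nth_mkseq.
Qed.

(** * Adjoining one element, and Hilbert's basis theorem *)

Section SimpleExtension.
Variables (B : subringClosed K) (t : K).

Definition simple_ext_pred (z : K) : bool :=
  `[< exists2 p : {poly K}, p \is a polyOver B & z = p.[t] >].

Lemma simple_ext_subring_closed : subring_closed simple_ext_pred.
Proof.
split=> [|_ _ /asboolP[p pB ->] /asboolP[q qB ->]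
         |_ _ /asboolP[p pB ->] /asboolP[q qB ->]]; apply/asboolP.
- by exists 1; rewrite ?rpred1 ?hornerE.
- by exists (p - q); rewrite ?rpredB ?hornerE.
- by exists (p * q); rewrite ?rpredM ?hornerE.
Qed.

HB.instance Definition _ :=
  GRing.isSubringClosed.Build K simple_ext_pred simple_ext_subring_closed.

Definition simple_ext : subringClosed K :=
  GRing.SubringClosed.clone K simple_ext_pred _.

Lemma simple_extP z :
  reflect (exists2 p : {poly K}, p \is a polyOver B & z = p.[t])
          (z \in simple_ext).
Proof. exact: asboolP. Qed.

Lemma sub_simple_ext : {subset B <= simple_ext}.
Proof.
by move=> z zB; apply/simple_extP; exists z%:P; rewrite ?polyOverC ?hornerE.
Qed.

Lemma mem_simple_ext : t \in simple_ext.
Proof. by apply/simple_extP; exists 'X; rewrite ?polyOverX ?hornerE. Qed.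

Lemma simple_ext_min (T : subringClosed K) :
  {subset B <= T} -> t \in T -> {subset simple_ext <= T}.
Proof.
move=> BT tT z /simple_extP[p /polyOverP pB ->]; rewrite horner_coef.
by apply: rpred_sum => i _; apply: rpredM; [exact/BT/pB | exact: rpredX].
Qed.

(* Hilbert's basis theorem: in the ideal of a sequence without relations, pick
   successively polynomials of least degree outside the span of the earlier
   ones; a relation between their leading coefficients lowers a degree. *)
Lemma noeth_simple_ext : noeth B -> noeth simple_ext.
Proof.
move=> Bn f fC; apply: contrapT => nof.
pose C := simple_ext; pose I x := exists n, in_span C n f x.
have I_in x n : in_span C n f x -> I x by exists n.
pose Q (q : {poly K}) := q \is a polyOver B /\ I q.[t].
pose S (s : seq {poly K}) x := in_span C (size s) (fun k => (s`_k).[t]) x.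
have [s sQ|g gP] := @dependent_sequence _ Q (fun s q => ~ S s q.[t] /\
    forall q', Q q' -> ~ S s q'.[t] -> (size q <= size q')%N).
  (* The values of the finitely many polynomials in [s] involve only the first [N] terms of [f], so
     [f N] is outside their span and a further choice exists. *)
  have [N sN] : exists N, forall q, q \in s -> in_span C N f q.[t].
    elim: s sQ => [|q s IHs] sQ; first by exists 0%N.
    have [|N NP] := IHs.
      by move=> q' q's; apply: sQ; rewrite inE q's orbT.
    have [|_ [M MP]] := sQ q; first exact: mem_head.
    exists (maxn N M) => q'; rewrite inE => /orP[/eqP->|/NP].
      by apply: in_span_le MP; apply: leq_maxr.
    by apply: in_span_le; apply: leq_maxl.
  have fN : ~ S s (f N).
    move=> SfN; apply: nof; exists N; apply: in_span_trans SfN => k ks.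
    by apply: sN; apply: mem_nth.
  have exm : exists m, `[< exists q, [/\ Q q, ~ S s q.[t] & size q = m] >].
    have /simple_extP[q qB fE] := fC N.
    exists (size q); apply/asboolP; exists q; split=> //; last by rewrite -fE.
    by split=> //; rewrite -fE; apply: I_in (in_span_gen _ _ (ltnSn N)).
  case: (ex_minnP exm) => m /asboolP[q [Qq Sq <-]] qmin.
  by exists q; split=> //; split=> // q' Qq' Sq'; apply: qmin; apply/asboolP;
    exists q'.
pose G k := (g k).[t].
have SE n x : S (mkseq g n) x <-> in_span C n G x.
  by rewrite /S size_mkseq; split; apply: eq_in_span => k kn; rewrite nth_mkseq.
have gB n : g n \is a polyOver B by have [[]] := gP n.
have gI n : I (g n).[t] by have [[]] := gP n.
have gS n : ~ in_span C n G (g n).[t] by have [_ []] := gP n; rewrite SE.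
have gmin n q : Q q -> ~ in_span C n G q.[t] -> (size (g n) <= size q)%N.
  by rewrite -SE; have [_ [_]] := gP n; apply.
have [n [c cB lcE]] := Bn (fun n => lead_coef (g n)) (fun n =>
  polyOverP (gB n) _).
(* At stage [k] the polynomial [g n] was already a candidate, being outside the smaller span. *)
have gle k : (k < n)%N -> (size (g k) <= size (g n))%N.
  move=> kn; apply: gmin; first by split.
  by move/(in_span_le (ltnW kn)); apply: gS.
(* The power of ['X] raises [g k] to the degree of [g n], so that the relation [lcE] cancels the
   leading coefficient of [g n] in [q]. *)
pose h k := c k *: (g k * 'X^(size (g n) - size (g k))).
pose q := g n - \sum_(k < n) h k.
have hB k : h k \is a polyOver B by rewrite polyOverZ ?rpredM ?polyOverXn.
have ht k : (h k).[t] = (c k * t ^+ (size (g n) - size (g k))) * G k.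
  by rewrite hornerZ hornerM hornerXn mulrA mulrAC.
have cC k : c k * t ^+ (size (g n) - size (g k)) \in C.
  by rewrite rpredM ?rpredX ?mem_simple_ext ?sub_simple_ext.
have gnq : g n = q + \sum_(k < n) h k by rewrite /q subrK.
have sumS : in_span C n G (\sum_(k < n) h k).[t].
  rewrite horner_sum.
  exists (fun k => c k * t ^+ (size (g n) - size (g k))) => //.
  by apply: eq_bigr => k _; rewrite ht.
have spanN m F x : in_span C m F x -> in_span C m F (- x).
  by rewrite -mulN1r; apply: in_spanZ; rewrite rpredN1.
have sumI : I (\sum_(k < n) h k).[t].
  have [N NP] : exists N, forall k, (k < n)%N -> in_span C N f (G k).
    elim: (n) => [|m [N NP]]; first by exists 0%N.
    have [M MP] := gI m; exists (maxn N M) => k; rewrite ltnS leq_eqVlt.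
    move=> /orP[/eqP->|/NP]; first by apply: in_span_le MP; apply: leq_maxr.
    by apply: in_span_le; apply: leq_maxl.
  by exists N; apply: in_span_trans sumS.
have qQ : Q q.
  split; first by rewrite rpredB ?rpred_sum // => k _; apply: hB.
  have [[N NP] [M MP]] := (gI n, sumI).
  exists (maxn N M); rewrite hornerD hornerN; apply: in_spanD.
    by apply: in_span_le NP; apply: leq_maxl.
  by apply: spanN; apply: in_span_le MP; apply: leq_maxr.
have qS : ~ in_span C n G q.[t].
  by move=> qS; apply: (gS n); rewrite gnq hornerD; apply: in_spanD.
have := gmin n q qQ qS; apply/negP; rewrite -ltnNge.
have gn0 : g n != 0.
  apply/eqP => gn0; apply: (gS n); rewrite gn0 horner0; exact: in_span0.
have sg : (0 < size (g n))%N by rewrite size_poly_gt0.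
(* The index [(size (g n)).-1] is that of the leading coefficient, where [lcE] gives cancellation;
   beyond it every term vanishes. *)
rewrite -(prednK sg) ltnS; apply/leq_sizeP => j.
rewrite leq_eqVlt => /orP[/eqP<-|].
  rewrite coefB coef_sum -lead_coefE lcE -sumrB big1 // => k _.
  rewrite coefZ coefMXn.
  have gk0 : g k != 0.
    apply/eqP => gk0; apply: (gS k); rewrite gk0 horner0; exact: in_span0.
  have sgk : (0 < size (g k))%N by rewrite size_poly_gt0.
  have := gle k (ltn_ord k) => sgle.
  have -> : ((size (g n)).-1 < size (g n) - size (g k))%N = false by lia.
  have -> : ((size (g n)).-1 - (size (g n) - size (g k)) = (size (g k)).-1)%N.
    by lia.
  by rewrite -lead_coefE subrr.
rewrite (prednK sg) => jn.
rewrite coefB coef_sum nth_default // sub0r big1 ?oppr0 // => k _.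
rewrite coefZ coefMXn; case: ltnP => _; first by rewrite mulr0.
have := gle k (ltn_ord k) => sgle.
rewrite nth_default ?mulr0 //.
by apply: leq_trans (leq_sub2r _ jn); rewrite subKn.
Qed.

End SimpleExtension.

(** The ring [C] is B[s], built one element at a time; the minimality clause allows it to be
    identified with [adjoin]. *)
Lemma noeth_finite_ext B (s : seq K) : noeth B ->
  exists C : subringClosed K, [/\ noeth C, {subset B <= C}, {subset s <= C} &
    forall T : subringClosed K, {subset B <= T} -> {subset s <= T} ->
      {subset C <= T}].
Proof.
move=> Bn; elim: s => [|t s [C [Cn BC sC Cmin]]].
  by exists B; split=> // x.
exists (simple_ext C t); split.
- exact: noeth_simple_ext.
- by move=> x /BC; apply: sub_simple_ext.
- move=> x; rewrite inE => /orP[/eqP->|/sC]; first exact: mem_simple_ext.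
  exact: sub_simple_ext.
- move=> T BT sT; apply: simple_ext_min; last by apply/sT/mem_head.
  by apply: Cmin => // x xs; apply: sT; rewrite inE xs orbT.
Qed.

(** A relation between the numerators becomes one between the fractions once [c k] is rescaled by
    [s k / s n], which lies in [L]. *)
Lemma noeth_localization B L : noeth B -> {subset B <= L} ->
  (forall z, z \in L -> exists a s,
     [/\ a \in B, s \in B, s != 0, s^-1 \in L & z = a / s]) ->
  noeth L.
Proof.
move=> Bn BL LP f fL.
have /choice[a /choice[s asP]] n := LP _ (fL n).
have [|n [c cB aE]] := Bn a; first by move=> n; have [] := asP n.
have [_ _ sn0 snL fE] := asP n.
exists n, (fun k => c k * s k / s n) => [k|].
  by have [_ skB _ _ _] := asP k; rewrite !rpredM // BL.
rewrite fE aE mulr_suml; apply: eq_bigr => k _.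
have [_ _ sk0 _ ->] := asP k.
by field; rewrite sn0 sk0.
Qed.

End Noetherian.

(** * The copy of a noetherian domain in its fraction field *)

Definition subring_elt (K : fieldType) (A : subringClosed K) (z : K)
    (zA : z \in A) : subring_type A :=
  exist _ z zA.

Lemma noeth_base_subring (R : idomainType) :
  noetherian R -> noeth (base_subring R).
Proof.
move=> Rn f fR; set B := base_subring R.
have tofracB r : tofrac r \in B by apply/asboolP; exists r.
pose I (r : R) := `[< exists n, in_span B n f (tofrac r) >].
(* An [idealr] is proper, so the case where the terms of [f] generate the unit ideal is settled
   apart. *)
have [/asboolP[n n1]|I1] := boolP (I 1).
  by exists n; rewrite -[f n]mulr1; apply: in_spanZ => //; rewrite -tofrac1.
have I_closed : idealr_closed I.
  split=> [||a u v /asboolP[n un] /asboolP[m vm]] //; apply/asboolP.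
    by exists 0%N; rewrite tofrac0; apply: in_span0.
  exists (maxn n m); rewrite tofracD tofracM; apply: in_spanD.
    by apply: in_spanZ => //; apply: in_span_le un; apply: leq_maxl.
  by apply: in_span_le vm; apply: leq_maxr.
pose J : idealr R := HB.pack I (isIdealr.Build R I I_closed).
have [m [g gP]] := Rn J.
have gJ i : g i \in J.
  apply/gP; exists (fun j => (j == i)%:R).
  rewrite (bigD1 i) //= eqxx mul1r big1 ?addr0 // => j /negPf->.
  by rewrite mul0r.
have /choice[N NP] i : exists n, in_span B n f (tofrac (g i)).
  exact/asboolP/gJ.
(* The first [M] terms of [f] span all the generators of [J], hence also [f M]. *)
pose M := \max_(i < m) N i; exists M.
have /asboolP[r fME] := fR M.
have /gP[c rE] : r \in J.
  by apply/asboolP; exists M.+1; rewrite -fME; apply: in_span_gen.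
rewrite fME rE rmorph_sum /=; elim/big_ind: _ => [|x y|i _].
- exact: in_span0.
- exact: in_spanD.
rewrite tofracM; apply: in_spanZ => //; apply: in_span_le (NP i).
exact: leq_bigmax.
Qed.

(** * Local monoidal transforms preserve noetherianity *)

Section LocalMonoidalTransform.
Variables (K : fieldType) (A : subringClosed K).
Variables (p : prime_idealr (subring_type A)) (x : subring_type A).

Lemma sub_adjoin : {subset A <= adjoin p x}.
Proof. by move=> z zA; apply/asboolP => T AT _; apply: AT. Qed.

Lemma div_mem_adjoin a : a \in p -> \val a / \val x \in adjoin p x.
Proof. by move=> ap; apply/asboolP => T _; apply. Qed.

Lemma adjoin_min (T : subringClosed K) :
  {subset A <= T} -> (forall a, a \in p -> \val a / \val x \in T) ->
  {subset adjoin p x <= T}.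
Proof. by move=> AT pT z /asboolP; apply. Qed.

(** Since [p] is finitely generated, A[p/x] arises from [A] by adjoining the finitely many quotients
    of generators by [x]. *)
Lemma noeth_adjoin : noeth A -> noeth (adjoin p x).
Proof.
move=> An.
have [_ [a _ <-]|s [sp sgen]] := @noeth_finitely_generated _ A
  (fun z => exists2 a, a \in p & \val a = z) An; first exact: valP.
have [C [Cn AC sC Cmin]] := noeth_finite_ext [seq z / \val x | z <- s] An.
apply: eq_noeth Cn => z; apply/idP/idP.
  apply: Cmin => [|_ /mapP[_ /sp[a ap <-] ->]]; first exact: sub_adjoin.
  exact: div_mem_adjoin.
apply: adjoin_min => // a ap.
have [|c cA ->] := sgen (\val a); first by exists a.
rewrite mulr_suml; apply: rpred_sum => k _; rewrite -mulrA.
by apply: rpredM; [exact: AC | apply/sC/map_f/mem_nth].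
Qed.

Variable A1 : subringClosed K.
Hypothesis A1P : local_monoidal_transform p x A1.

Lemma transform_center_neq0 : \val x != 0.
Proof.
have [_ _ _ xp2 _] := A1P; apply/eqP => x0; apply: xp2.
(* Zero is the empty sum of products, hence in the square of [p]. *)
exists 0%N, (fun=> 0), (fun=> 0); split=> [[]//|].
by rewrite big_ord0; apply: val_inj.
Qed.

Lemma adjoin_sub_transform : {subset adjoin p x <= A1}.
Proof.
have [_ _ _ _ [m [m1 [_ _ _ A1E]]]] := A1P; move=> z zB; apply/A1E.
exists (subring_elt zB), 1; rewrite idealr1; split=> //.
by rewrite /= divr1.
Qed.

Lemma transform_frac z : z \in A1 -> exists a s,
  [/\ a \in adjoin p x, s \in adjoin p x, s != 0, s^-1 \in A1 & z = a / s].
Proof.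
have [_ _ _ _ [m [m1 [_ _ _ A1E]]]] := A1P.
move=> /A1E[a [s [sm1 ->]]]; exists (\val a), (\val s); split=> //.
- exact: valP.
- exact: valP.
- apply: contraNneq sm1 => s0.
  by rewrite (_ : s = 0) ?idealr0 //; apply: val_inj.
- by apply/A1E; exists 1, s; rewrite /= div1r.
Qed.

Lemma sub_transform : {subset A <= A1}.
Proof. by move=> z /sub_adjoin/adjoin_sub_transform. Qed.

Lemma noeth_transform : noeth A -> noeth A1.
Proof.
move=> An; apply: (noeth_localization (noeth_adjoin An)).
  exact: adjoin_sub_transform.
exact: transform_frac.
Qed.

End LocalMonoidalTransform.

(** * Localization at a prime of the union ring *)

Section LocalizationAtPrime.
Variables (K : fieldType) (V : subringClosed K).
Variable q : prime_idealr (subring_type V).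

(** The complement of [q] in [V] is taken inside [K], so that it applies directly to elements of any
    subring of [K]. *)
Definition outside (s : K) : Prop :=
  exists2 v : subring_type V, v \notin q & \val v = s.

Lemma outside1 : outside 1.
Proof. by exists 1; rewrite ?idealr1. Qed.

Lemma outsideM s t : outside s -> outside t -> outside (s * t).
Proof.
move=> [v vq <-] [w wq <-]; exists (v * w); last exact: rmorphM.
by rewrite prime_idealrM negb_or vq.
Qed.

Lemma outside_neq0 s : outside s -> s != 0.
Proof.
move=> [v vq <-]; apply: contraNneq vq => v0.
by rewrite (_ : v = 0) ?idealr0 //; apply: val_inj.
Qed.

Lemma outside_factor s t : s \in V -> t \in V -> outside (t * s) -> outside s.
Proof.
move=> sV tV [v vq vE]; exists (subring_elt sV) => //; apply: contra vq => sq.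
rewrite (_ : v = subring_elt tV * subring_elt sV) ?idealMr //.
by apply: val_inj; rewrite rmorphM.
Qed.

Lemma outside_unit s : s \in V -> s^-1 \in V -> s != 0 -> outside s.
Proof.
move=> sV sV' s0; apply: (outside_factor sV sV').
by rewrite mulVf //; apply: outside1.
Qed.

Section Localize.
Variable B : subringClosed K.

(** When [B] lies in [V], this is the localization of [B] at the contraction of [q]. *)
Definition localize_pred (z : K) : bool :=
  `[< exists a s, [/\ a \in B, s \in B, outside s & z = a / s] >].

Lemma localize_subring_closed : subring_closed localize_pred.
Proof.
split=> [|_ _ /asboolP[a [s [aB sB sq ->]]] /asboolP[b [t [bB tB tq ->]]]
         |_ _ /asboolP[a [s [aB sB sq ->]]] /asboolP[b [t [bB tB tq ->]]]];
  apply/asboolP.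
- by exists 1, 1; rewrite !rpred1 divr1; split=> //; apply: outside1.
- exists (a * t - b * s), (s * t); rewrite rpredB ?rpredM //; split=> //.
    exact: outsideM.
  by field; rewrite !outside_neq0.
- exists (a * b), (s * t); rewrite !rpredM //; split=> //.
    exact: outsideM.
  by field; rewrite !outside_neq0.
Qed.

HB.instance Definition _ :=
  GRing.isSubringClosed.Build K localize_pred localize_subring_closed.

Definition localize : subringClosed K :=
  GRing.SubringClosed.clone K localize_pred _.

Lemma localizeP z :
  reflect (exists a s, [/\ a \in B, s \in B, outside s & z = a / s])
          (z \in localize).
Proof. exact: asboolP. Qed.

Lemma sub_localize : {subset B <= localize}.
Proof.
move=> z zB; apply/localizeP; exists z, 1.
by rewrite rpred1 divr1; split=> //; apply: outside1.
Qed.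

Lemma localize_inv s : s \in localize -> outside s -> s^-1 \in localize.
Proof.
move=> /localizeP[a [t [aB tB tq sE]]] sq; apply/localizeP; exists t, a.
have aE : a = s * t by rewrite sE divfK ?outside_neq0.
by split=> //; [rewrite aE; apply: outsideM | rewrite sE invf_div].
Qed.

Lemma noeth_localize : noeth B -> noeth localize.
Proof.
move=> Bn; apply: (noeth_localization Bn) => [|z /localizeP[a [s []]]].
  exact: sub_localize.
move=> aB sB sq zE; exists a, s; split=> //; first exact: outside_neq0.
exact: localize_inv (sub_localize sB) sq.
Qed.

End Localize.

(** Since y = (y/x) x with y/x in [V], also [x] is outside [q], so the quotients by [x] are already
    in the localization. The denominators in [A1] are units of [V], hence outside [q] too. The ring
    [C] stays fixed while [A] runs through successive transforms. *)
Lemma transform_sub_localize (A A1 : subringClosed K)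
    (p : prime_idealr (subring_type A)) (x y : subring_type A)
    (C : subringClosed K) :
  local_monoidal_transform p x A1 -> {subset A1 <= V} ->
  y \in p -> outside (\val y) ->
  {subset A <= localize C} -> {subset A1 <= localize C}.
Proof.
move=> A1P A1V yp yq AC.
have BA1 := adjoin_sub_transform A1P.
have xV : \val x \in V by apply/A1V/(sub_transform A1P)/valP.
have xq : outside (\val x).
  apply: (outside_factor xV (t := \val y / \val x)).
    exact/A1V/BA1/div_mem_adjoin.
  by rewrite divfK // (transform_center_neq0 A1P).
have BC : {subset adjoin p x <= localize C}.
  apply: adjoin_min => // a _; apply: rpredM; first exact/AC/valP.
  by apply: localize_inv xq; apply/AC/valP.
move=> z /(transform_frac A1P)[a [s [aB sB s0 s1 ->]]].
apply: rpredM; first exact: BC.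
apply: localize_inv; first exact: BC.
by apply: outside_unit => //; apply: A1V => //; apply: BA1.
Qed.

End LocalizationAtPrime.

(* For a in P2 \ P1 and b in P1 \ P0 all the b / a ^+ n are in V; a relation
   between them makes a invertible in the local ring at P2. *)
Lemma valuation_noeth_localize (K : fieldType) (V C : subringClosed K)
    (P0 P1 P2 : prime_idealr (subring_type V)) :
  valuation_ring V -> {subset C <= V} -> {subset V <= localize P2 C} ->
  noeth (localize P2 C) ->
  ~ {subset P1 <= P0} -> {subset P2 <= P1}.
Proof.
move=> Vval CV VL Ln P10 a aP2; apply: contrapT => /negP aP1.
have [b bP1 bP0] : exists2 b, b \in P1 & b \notin P0.
  apply: contrapT => nob; apply: P10 => b bP1; apply: contrapT => /negP bP0.
  by apply: nob; exists b.
have a0 : \val a != 0 by apply: outside_neq0; exists a; first exact: aP1.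
have b0 : \val b != 0 by apply: outside_neq0; exists b; first exact: bP0.
have aX n : a ^+ n \notin P1.
  elim: n => [|n IHn]; first by rewrite expr0 idealr1.
  by rewrite exprS prime_idealrM negb_or aP1.
(* Otherwise the inverse a^n/b is in [V], and multiplying it by [b] puts a^n in [P1]. *)
have bV n : \val b / \val a ^+ n \in V.
  have [|//|cV] := Vval (\val b / \val a ^+ n).
    by rewrite mulf_neq0 // invr_eq0 expf_neq0.
  case/negP: (aX n); rewrite (_ : a ^+ n = subring_elt cV * b) ?idealMr //.
  by apply: val_inj; rewrite rmorphXn rmorphM /= invf_div divfK.
have [|n [c cL bE]] := Ln (fun n => \val b / \val a ^+ n).
  by move=> n; apply: VL.
have : (\val a)^-1 \in localize P2 C.
  (* This is the relation [bE] divided by (b/a^n) a; the exponents are true differences because k <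
     n. *)
  have -> : (\val a)^-1 = \sum_(k < n) c k * \val a ^+ (n - k.+1).
    apply: (mulfI (x := \val b / \val a ^+ n * \val a)).
      by rewrite !mulf_neq0 // invr_eq0 expf_neq0.
    rewrite mulfK // [LHS]bE mulr_sumr; apply: eq_bigr => k _.
    have -> : \val a ^+ n = \val a ^+ (n - k.+1) * \val a * \val a ^+ k.
      by rewrite -exprSr -exprD; congr (_ ^+ _); have := ltn_ord k; lia.
    by field; rewrite ?expf_neq0 ?a0.
  apply: rpred_sum => k _; apply: rpredM; first exact: cL.
  exact/rpredX/VL/valP.
(* From 1/a = u/v follows v = u a, which lies in [P2], although the denominator [v] was taken
   outside it. *)
move=> /localizeP[u [s [uC _ [v vP2 <-] aE]]]; case/negP: vP2.
have v0 : \val v != 0.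
  by apply: contraNneq a0 => v0; rewrite -invr_eq0 aE v0 invr0 mulr0.
rewrite (_ : v = subring_elt (CV u uC) * a) ?idealMr //.
by apply: val_inj; rewrite rmorphM /= -[u](divfK v0) -aE mulrAC mulVf ?mul1r.
Qed.

(** * Contraction of primes to a subring *)

Section Contraction.
Variables (K : fieldType) (B V : subringClosed K) (BV : {subset B <= V}).
Variable q : prime_idealr (subring_type V).

Definition incl (a : subring_type B) : subring_type V :=
  subring_elt (BV (valP a)).

Definition contract_pred (a : subring_type B) : bool := incl a \in q.

Lemma contract_predE a : (a \in contract_pred) = (incl a \in q).
Proof. by []. Qed.

Lemma contract_idealr_closed : idealr_closed contract_pred.
Proof.
split=> [||a u v]; rewrite !contract_predE.
- by rewrite (_ : incl 0 = 0) ?idealr0 //; apply: val_inj.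
- by rewrite (_ : incl 1 = 1) ?idealr1 //; apply: val_inj.
move=> uq vq; rewrite (_ : incl _ = incl a * incl u + incl v).
  by rewrite rpredD ?idealMr.
exact: val_inj.
Qed.

Lemma contract_prime : prime_idealr_closed contract_pred.
Proof.
move=> u v; rewrite !contract_predE -prime_idealrM.
by rewrite (_ : incl (u * v) = incl u * incl v) //; apply: val_inj.
Qed.

HB.instance Definition _ :=
  isIdealr.Build (subring_type B) contract_pred contract_idealr_closed.
HB.instance Definition _ :=
  isPrimeIdealrClosed.Build (subring_type B) contract_pred contract_prime.

Definition contract : prime_idealr (subring_type B) :=
  PrimeIdealr.clone _ contract_pred _.

Lemma mem_contract a : (a \in contract) = (incl a \in q).
Proof. by []. Qed.

End Contraction.

(** * Chains of primes and heights *)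

Lemma prime_chain_cat (A : comNzRingType) (h l : nat)
    (P : 'I_h.+1 -> prime_idealr A) (Q : 'I_l.+1 -> prime_idealr A) :
  prime_chain P -> prime_chain Q -> {subset P ord_max <= Q ord0} ->
  exists C : 'I_(h + l).+1 -> prime_idealr A, prime_chain C.
Proof.
move=> Pch Qch PQ.
(* The prime [Q ord0] is skipped, because it may coincide with [P ord_max]; hence the length
   [h + l]. *)
exists (fun i => if (i <= h)%N then P (inord i) else Q (inord (i - h))).
move=> i j ij; have := ltn_ord j; rewrite ltnS => jhl.
have [jh|hj] := leqP j h.
  rewrite (leq_trans (ltnW ij) jh); apply: Pch.
  by rewrite !inordK ?ltnS // (leq_trans (ltnW ij)).
have [ih|hi] := leqP i h; last by apply: Qch; rewrite !inordK; lia.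
have [Q0j Qj0] : {subset Q ord0 <= Q (inord (j - h))} /\
    ~ {subset Q (inord (j - h)) <= Q ord0}.
  by apply: Qch; rewrite /= inordK; lia.
have Pih : {subset P (inord i) <= P ord_max}.
  have [->|ih'] := eqVneq (inord i) (ord_max : 'I_h.+1); first by [].
  apply: (Pch _ _ _).1; move: ih'; rewrite -val_eqE /= inordK ?ltnS //.
  by move=> ih'; rewrite ltn_neqAle ih'.
split=> [z /Pih/PQ/Q0j//|QP]; apply: Qj0 => z /QP/Pih/PQ; exact.
Qed.

(** The inequality ht p + dim A/p <= dim A, stated with chains: a chain ending at [p] is continued
    by the chain above it. *)
Lemma height_ge_chain_above (A : comNzRingType) (p : prime_idealr A)
    (d h l : nat) (Q : 'I_l.+1 -> prime_idealr A) :
  krull_dim_le A d -> height_ge p h -> prime_chain Q ->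
  {subset p <= Q ord0} -> (h + l <= d)%N.
Proof.
move=> dimA [k [P [hk Pch PE]]] Qch pQ.
have [z|C Cch] := prime_chain_cat Pch Qch; first by rewrite PE; apply: pQ.
by apply: leq_trans (dimA _ _ Cch); rewrite leq_add2r.
Qed.

(** * The bound on the dimension of the valuation ring *)

Theorem theorem4p8 (R : idomainType) (d i : nat) (V : subringClosed {fraction R})
    (hR : regular_local_ring R) (hd : krull_dim_eq R d) (hd2 : (2 <= d)%N)
    (hi : (i <= d - 2)%N) (hV : monoidal_Shannon (d - i)%N V)
    (hval : valuation_ring V) :
  krull_dim_le (subring_type V) (i + 2)%N.
Proof.
have [Rn [p [x [R0 dimE Rtr pht VE]]]] := hV.
have dimRn n : krull_dim_le (subring_type (Rn n)) d := ((dimE n d).2 hd).2.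
have Rmono m n : (m <= n)%N -> {subset Rn m <= Rn n}.
  move=> /subnK<-; elim: (n - m)%N => // j IHj z /IHj.
  exact: sub_transform (Rtr _) _.
have RV n : {subset Rn n <= V} by move=> z zn; apply/VE; exists n.
have Rnoeth n : noeth (Rn n).
  elim: n => [|n IHn]; last exact: noeth_transform (Rtr n) IHn.
  apply: eq_noeth (noeth_base_subring hR.1) => z; exact/esym/R0.
move=> k P Pch; rewrite leqNgt; apply/negP => ik.
have Plt a b : (a < b <= k)%N -> ~ {subset P (inord b) <= P (inord a)}.
  by move=> /andP[ab bk]; apply: (Pch _ _ _).2; rewrite !inordK; lia.
have [centers|] := pselect (forall N, exists n, (N <= n)%N /\
    {subset p n <= contract (RV n) (P (inord 2))}); last first.
  move=> /existsNP[N Nout]; set P2 := P _ in Nout.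
  (* From stage [N] on, each center has an element outside [P2], so every later transform stays
     inside the localization of [Rn N]. *)
  have VL : {subset V <= localize P2 (Rn N)}.
    move=> z /VE[n zn]; have {zn} : z \in Rn (n + N)%N.
      by apply: Rmono zn; apply: leq_addr.
    elim: n z => [|n IHn]; first exact: sub_localize.
    have [y yp yP2] : exists2 y, y \in p (n + N)%N &
        y \notin contract (RV (n + N)%N) P2.
      apply: contrapT => noy; apply: Nout; exists (n + N)%N; split.
        exact: leq_addl.
      by move=> y yp; apply: contrapT => /negP yP2; apply: noy; exists y.
    apply: transform_sub_localize (Rtr _) _ yp _ IHn; first exact: RV.
    by exists (incl (RV _) y).
  apply: (Plt 1%N 2%N); first by lia.
  apply: valuation_noeth_localize hval (RV N) VL _ (Plt 0%N 1%N _); last by lia.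
  exact: noeth_localize (Rnoeth N).
(* An element separating two primes of the chain lies in some [Rn N] and separates their
   contractions from there on. There are finitely many pairs, so the maximum of these bounds serves
   them all. *)
have /choice[N NP] (ab : 'I_k.+1 * 'I_k.+1) : exists N, forall n, (N <= n)%N ->
    (ab.1 < ab.2)%N ->
    ~ {subset contract (RV n) (P ab.2) <= contract (RV n) (P ab.1)}.
  case: ab => a b /=; have [ab|_] := ltnP a b; last by exists 0%N.
  have [z zb za] : exists2 z, z \in P b & z \notin P a.
    apply: contrapT => noz; apply: (Pch a b ab).2 => z zb.
    by apply: contrapT => /negP za; apply: noz; exists z.
  have /VE[N zN] := valP z; exists N => n Nn _ sub.
  have zn := Rmono _ _ Nn _ zN.
  have zE : incl (RV n) (subring_elt zn) = z by apply: val_inj.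
  have := sub (subring_elt zn).
  by rewrite !mem_contract zE zb (negPf za) => /(_ isT).
have [n [Mn pn]] := centers (\max_ab N ab).
(* The shift by 2 makes the chain start at the contraction of P_2, which contains [p n]. Its length
   k - 2 exceeds i, so together with the height d - i it exceeds d. *)
pose Q (j : 'I_(k - 2).+1) := contract (RV n) (P (inord (j + 2))).
have Qch : prime_chain Q.
  move=> a b ab; have := ltn_ord b => bk.
  have ab' : ((inord (a + 2) : 'I_k.+1) < (inord (b + 2) : 'I_k.+1))%N.
    by rewrite !inordK; lia.
  split; first by move=> z; rewrite !mem_contract; apply: (Pch _ _ ab').1.
  apply: (NP (_, _)) ab'; apply: leq_trans Mn; exact: leq_bigmax.
have := height_ge_chain_above (dimRn n) (pht n) Qch pn; lia.
Qed.
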